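(* Let $\mathcal{C}$ be a symmetric strict monoidal category whose monoidal product is the cartesian product $\times$ (with unit the terminal object $1$). For all objects $A, A', B, B'$ of $\mathcal{C}$ there is an adjunction $R \dashv E$ between the set $\mathbf{Lens}_{\mathrm{Cart}}(\mathcal{C})((A,A'),(B,B'))$, regarded as a discrete category, and the category $\mathbf{2}\text{-}\mathbf{Optic}(\mathcal{C})((A,A'),(B,B'))$, $$R : \mathbf{Lens}_{\mathrm{Cart}}(\mathcal{C})((A,A'),(B,B')) \rightleftarrows \mathbf{2}\text{-}\mathbf{Optic}(\mathcal{C})((A,A'),(B,B')) : E,$$ given by the following data: 1. The left adjoint $R$ (residual reifier) is $R(f,f') := (A, \mathrm{graph}(f), f')$ on lenses (and trivial on morphisms, as its domain is discrete). 2. The right adjoint $E$ (residual eraser) is $E(M, \mathsf{fw}, \mathsf{bw}) := \bigl(\mathsf{fw} ; \pi_2,\ ((\mathsf{fw} ; \pi_1) \times B') ; \mathsf{bw}\bigr)$ on objects, and it sends every morphism to an identity. 3. The unit $\eta$ is the identity transformation. 4. The counit $\epsilon$ has as component at $(M, \mathsf{fw}, \mathsf{bw})$ the optic morphism $\epsilon_{(M,\mathsf{fw},\mathsf{bw})} : R(E(M,\mathsf{fw},\mathsf{bw})) \Rightarrow (M,\mathsf{fw},\mathsf{bw})$ given by the reparameterisation $\mathsf{fw} ; \pi_1 : A \to M$ in $\mathcal{C}$.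
   Context: Composition is written in diagrammatic order: for $f : A \to B$ and $g : B \to C$, $f ; g : A \to C$. An object is used to denote its identity morphism, e.g. $r \times B$ means $r \times \mathrm{id}_B$. The projections of a product $X \times Y$ are $\pi_1 : X \times Y \to X$ and $\pi_2 : X \times Y \to Y$. Symmetric strict monoidal means that associators and unitors are identities (the symmetry need not be). Graph: for $f : A \to B$, $\mathrm{graph}(f) : A \to A \times B$ is $\Delta_A ; (A \times f)$, where $\Delta_A : A \to A \times A$ is the diagonal. Lenses: the set $\mathbf{Lens}_{\mathrm{Cart}}(\mathcal{C})((A,A'),(B,B'))$ consists of pairs $(f,f')$ of morphisms $f : A \to B$ and $f' : A \times B' \to A'$ of $\mathcal{C}$. Hom-category of 2-optics: the category $\mathbf{2}\text{-}\mathbf{Optic}(\mathcal{C})((A,A'),(B,B'))$ (here with $\otimes = \times$) has as objects triples $(M, \mathsf{fw}, \mathsf{bw})$ with $M$ an object of $\mathcal{C}$, $\mathsf{fw} : A \to M \otimes B$ and $\mathsf{bw} : M \otimes B' \to A'$. A morphism $(M_1, \mathsf{fw}_1, \mathsf{bw}_1) \Rightarrow (M_2, \mathsf{fw}_2, \mathsf{bw}_2)$ (an optic morphism, or reparameterisation) is a morphism $r : M_1 \to M_2$ of $\mathcal{C}$ such that $\mathsf{fw}_1 ; (r \otimes B) = \mathsf{fw}_2$ and $(r \otimes B') ; \mathsf{bw}_2 = \mathsf{bw}_1$. Identities and composition of morphisms are those of $\mathcal{C}$. *)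

(* Defs.v *)
From Stdlib Require Import ProofIrrelevance.

Set Implicit Arguments.
Unset Strict Implicit.
Unset Printing Implicit Defensive.

Declare Scope cat_scope.
Delimit Scope cat_scope with cat.
Open Scope cat_scope.

(* Composition is diagrammatic throughout: [f ;; g] is "first f, then g". *)
Record Category := {
  Ob :> Type;
  Hom : Ob -> Ob -> Type;
  idm : forall A, Hom A A;
  comp : forall A B C, Hom A B -> Hom B C -> Hom A C;
  comp_idl : forall A B (f : Hom A B), comp (idm A) f = f;
  comp_idr : forall A B (f : Hom A B), comp f (idm B) = f;
  comp_assoc : forall A B C D (f : Hom A B) (g : Hom B C) (h : Hom C D),
    comp (comp f g) h = comp f (comp g h)
}.

Arguments Hom {c} A B.
Arguments idm {c} A.
Arguments comp {c A B C} f g.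

Notation "f ;; g" := (comp f g) (at level 50, left associativity) : cat_scope.

(* [is_identity f] for [f : Hom A B] says that [A] and [B] are the same object
   and that [f] is its identity morphism. *)
Inductive is_identity {C : Category} : forall A B : C, Hom A B -> Prop :=
| is_identity_idm : forall A : C, is_identity (idm A).

Definition is_iso {C : Category} {A B : C} (f : Hom A B) : Prop :=
  exists g : Hom B A, f ;; g = idm A /\ g ;; f = idm B.

(* The object map is a parameter, so that the morphism part of a functor with
   a prescribed action on objects can be quantified over. *)
Record FunctorOn (C D : Category) (F : C -> D) := {
  fmap_on : forall A B : C, Hom A B -> Hom (F A) (F B);
  fmap_on_id : forall A, fmap_on (idm A) = idm (F A);
  fmap_on_comp : forall A B E (f : Hom A B) (g : Hom B E),
    fmap_on (f ;; g) = fmap_on f ;; fmap_on g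
}.

Record Functor (C D : Category) := {
  fobj :> C -> D;
  fstr : FunctorOn fobj
}.

Definition fmap {C D : Category} (F : Functor C D) {A B : C} (f : Hom A B) :
  Hom (F A) (F B) := fmap_on (fstr F) f.

Definition functor_id (C : Category) : Functor C C :=
  {| fobj := fun A => A;
     fstr := {| fmap_on := fun A B (f : Hom A B) => f;
                fmap_on_id := fun A => eq_refl;
                fmap_on_comp := fun A B E f g => eq_refl |} |}.

Lemma functor_comp_id {C D E : Category} (F : Functor C D) (G : Functor D E)
  (A : C) : fmap G (fmap F (idm A)) = idm (G (F A)).
Proof. unfold fmap. rewrite !fmap_on_id. reflexivity. Qed.

Lemma functor_comp_comp {C D E : Category} (F : Functor C D) (G : Functor D E)
  (A B B' : C) (f : Hom A B) (g : Hom B B') :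
  fmap G (fmap F (f ;; g)) = fmap G (fmap F f) ;; fmap G (fmap F g).
Proof. unfold fmap. rewrite !fmap_on_comp. reflexivity. Qed.

Definition functor_comp {C D E : Category} (F : Functor C D) (G : Functor D E) :
  Functor C E :=
  {| fobj := fun A => G (F A);
     fstr := {| fmap_on := fun A B (f : Hom A B) => fmap G (fmap F f);
                fmap_on_id := functor_comp_id F G;
                fmap_on_comp := @functor_comp_comp C D E F G |} |}.

Record NatTrans {C D : Category} (F G : Functor C D) := {
  nat_at :> forall A : C, Hom (F A) (G A);
  nat_natural : forall (A B : C) (f : Hom A B),
    fmap F f ;; nat_at B = nat_at A ;; fmap G f
}.

Lemma nat_id_natural {C D : Category} (F : Functor C D) (A B : C) (f : Hom A B) :
  fmap F f ;; idm (F B) = idm (F A) ;; fmap F f.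
Proof. rewrite comp_idl, comp_idr. reflexivity. Qed.

Definition nat_id {C D : Category} (F : Functor C D) : NatTrans F F :=
  {| nat_at := fun A => idm (F A); nat_natural := @nat_id_natural C D F |}.

(* [is_identity_trans t] for [t : NatTrans F G] says that [F] and [G] are the
   same functor and that [t] is its identity transformation. *)
Inductive is_identity_trans {C D : Category} :
  forall F G : Functor C D, NatTrans F G -> Prop :=
| is_identity_trans_nat_id : forall F, is_identity_trans (nat_id F).

(* [Adjunction L R] is the data of an adjunction with [L] left adjoint to [R]. *)
Record Adjunction {C D : Category} (L : Functor C D) (R : Functor D C) := {
  adj_unit : NatTrans (functor_id C) (functor_comp L R);
  adj_counit : NatTrans (functor_comp R L) (functor_id D);
  adj_triangle_left : forall A : C,
    fmap L (adj_unit A) ;; adj_counit (L A) = idm (L A);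
  adj_triangle_right : forall X : D,
    adj_unit (R X) ;; fmap R (adj_counit X) = idm (R X)
}.

Definition discrete (T : Type) : Category :=
  {| Ob := T;
     Hom := fun x y => x = y;
     idm := fun x => eq_refl;
     comp := fun x y z (p : x = y) (q : y = z) => eq_trans p q;
     comp_idl := fun x y p => eq_trans_refl_l p;
     comp_idr := fun x y p => eq_trans_refl_r p;
     comp_assoc := fun x y z t p q r => eq_sym (eq_trans_assoc p q r) |}.

Class SymMonoidal (C : Category) := {
  tens : C -> C -> C;
  thom : forall {A A' B B' : C},
    Hom A A' -> Hom B B' -> Hom (tens A B) (tens A' B');
  munit : C;
  massoc : forall X Y Z : C, Hom (tens (tens X Y) Z) (tens X (tens Y Z));
  mlunit : forall X : C, Hom (tens munit X) X;
  mrunit : forall X : C, Hom (tens X munit) X;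
  msym : forall X Y : C, Hom (tens X Y) (tens Y X);
  thom_id : forall X Y : C, thom (idm X) (idm Y) = idm (tens X Y);
  thom_comp : forall (X X' X'' Y Y' Y'' : C)
    (f : Hom X X') (f' : Hom X' X'') (g : Hom Y Y') (g' : Hom Y' Y''),
    thom (f ;; f') (g ;; g') = thom f g ;; thom f' g';
  massoc_iso : forall X Y Z : C, is_iso (massoc X Y Z);
  mlunit_iso : forall X : C, is_iso (mlunit X);
  mrunit_iso : forall X : C, is_iso (mrunit X);
  massoc_natural : forall (X X' Y Y' Z Z' : C)
    (f : Hom X X') (g : Hom Y Y') (h : Hom Z Z'),
    thom (thom f g) h ;; massoc X' Y' Z' = massoc X Y Z ;; thom f (thom g h);
  mlunit_natural : forall (X X' : C) (f : Hom X X'),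
    thom (idm munit) f ;; mlunit X' = mlunit X ;; f;
  mrunit_natural : forall (X X' : C) (f : Hom X X'),
    thom f (idm munit) ;; mrunit X' = mrunit X ;; f;
  msym_natural : forall (X X' Y Y' : C) (f : Hom X X') (g : Hom Y Y'),
    thom f g ;; msym X' Y' = msym X Y ;; thom g f;
  mpentagon : forall W X Y Z : C,
    thom (massoc W X Y) (idm Z) ;; massoc W (tens X Y) Z
      ;; thom (idm W) (massoc X Y Z)
    = massoc (tens W X) Y Z ;; massoc W X (tens Y Z);
  mtriangle : forall X Y : C,
    massoc X munit Y ;; thom (idm X) (mlunit Y) = thom (mrunit X) (idm Y);
  mhexagon : forall X Y Z : C,
    massoc X Y Z ;; msym X (tens Y Z) ;; massoc Y Z X
    = thom (msym X Y) (idm Z) ;; massoc Y X Z ;; thom (idm Y) (msym X Z);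
  msym_invol : forall X Y : C, msym X Y ;; msym Y X = idm (tens X Y)
}.

Notation "A ⊗ B" := (tens A B) (at level 40, left associativity) : cat_scope.
Notation "f ⊗₁ g" := (thom f g) (at level 40, left associativity) : cat_scope.

Record is_strict {C : Category} (M : SymMonoidal C) : Prop := {
  strict_assoc : forall X Y Z : C, is_identity (massoc X Y Z);
  strict_lunit : forall X : C, is_identity (mlunit X);
  strict_runit : forall X : C, is_identity (mrunit X)
}.

(* The monoidal structure is the cartesian one: [X ⊗ Y] is a product of [X] and
   [Y], the unit is terminal, and the action of the tensor on morphisms and all
   the structure morphisms are the canonical ones induced by the projections. *)
Class Cartesian (C : Category) (M : SymMonoidal C) := {
  pi1 : forall {X Y : C}, Hom (X ⊗ Y) X;
  pi2 : forall {X Y : C}, Hom (X ⊗ Y) Y;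
  pairing : forall {Z X Y : C}, Hom Z X -> Hom Z Y -> Hom Z (X ⊗ Y);
  bang : forall X : C, Hom X munit;
  pairing_pi1 : forall (Z X Y : C) (f : Hom Z X) (g : Hom Z Y),
    pairing f g ;; pi1 = f;
  pairing_pi2 : forall (Z X Y : C) (f : Hom Z X) (g : Hom Z Y),
    pairing f g ;; pi2 = g;
  pairing_unique : forall (Z X Y : C) (h : Hom Z (X ⊗ Y)),
    h = pairing (h ;; pi1) (h ;; pi2);
  bang_unique : forall (X : C) (h : Hom X munit), h = bang X;
  thom_pairing : forall (X X' Y Y' : C) (f : Hom X X') (g : Hom Y Y'),
    f ⊗₁ g = pairing (pi1 ;; f) (pi2 ;; g);
  massoc_pairing : forall X Y Z : C,
    massoc X Y Z = pairing (pi1 ;; pi1) (pairing (pi1 ;; pi2) pi2);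
  mlunit_pi2 : forall X : C, mlunit X = pi2;
  mrunit_pi1 : forall X : C, mrunit X = pi1;
  msym_pairing : forall X Y : C, msym X Y = pairing pi2 pi1
}.

Definition diag {C : Category} {M : SymMonoidal C} {K : Cartesian M} (A : C) :
  Hom A (A ⊗ A) := pairing (idm A) (idm A).

Definition graph {C : Category} {M : SymMonoidal C} {K : Cartesian M} {A B : C}
  (f : Hom A B) : Hom A (A ⊗ B) := diag A ;; (idm A ⊗₁ f).

Record Lens {C : Category} (M : SymMonoidal C) (A A' B B' : C) := {
  lget : Hom A B;
  lput : Hom (A ⊗ B') A'
}.

Record Optic {C : Category} (M : SymMonoidal C) (A A' B B' : C) := {
  residual : C;
  fw : Hom A (residual ⊗ B);
  bw : Hom (residual ⊗ B') A'
}.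

Section OpticCategory.
Context {C : Category} (M : SymMonoidal C) (A A' B B' : C).
Implicit Types o : Optic M A A' B B'.

Definition is_optic_mor o1 o2 (r : Hom (residual o1) (residual o2)) : Prop :=
  fw o1 ;; (r ⊗₁ idm B) = fw o2 /\ (r ⊗₁ idm B') ;; bw o2 = bw o1.

Record OpticMor o1 o2 := {
  reparam : Hom (residual o1) (residual o2);
  reparamP : is_optic_mor reparam
}.

Lemma OpticMor_eq o1 o2 (r s : OpticMor o1 o2) :
  reparam r = reparam s -> r = s.
Proof.
destruct r as [r Hr], s as [s Hs]; simpl; intros E; subst s.
rewrite (proof_irrelevance _ Hr Hs). reflexivity.
Qed.

Lemma optic_id_subproof o : is_optic_mor (o1 := o) (o2 := o) (idm (residual o)).
Proof. split; rewrite thom_id; [apply comp_idr | apply comp_idl]. Qed.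

Lemma optic_comp_subproof o1 o2 o3 (r : OpticMor o1 o2) (s : OpticMor o2 o3) :
  is_optic_mor (o1 := o1) (o2 := o3) (reparam r ;; reparam s).
Proof.
destruct r as [r [Hr1 Hr2]], s as [s [Hs1 Hs2]]; simpl; split.
- rewrite <- (comp_idl (idm B)), thom_comp, <- comp_assoc, Hr1. exact Hs1.
- rewrite <- (comp_idl (idm B')), thom_comp, comp_assoc, Hs2. exact Hr2.
Qed.

Definition optic_id o : OpticMor o o :=
  {| reparam := idm (residual o); reparamP := optic_id_subproof o |}.

Definition optic_comp o1 o2 o3 (r : OpticMor o1 o2) (s : OpticMor o2 o3) :
  OpticMor o1 o3 :=
  {| reparam := reparam r ;; reparam s; reparamP := optic_comp_subproof r s |}.

Definition TwoOptic : Category :=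
  {| Ob := Optic M A A' B B';
     Hom := OpticMor;
     idm := optic_id;
     comp := optic_comp;
     comp_idl := fun o1 o2 (f : OpticMor o1 o2) =>
       OpticMor_eq (r := optic_comp (optic_id o1) f) (comp_idl (reparam f));
     comp_idr := fun o1 o2 (f : OpticMor o1 o2) =>
       OpticMor_eq (r := optic_comp f (optic_id o2)) (comp_idr (reparam f));
     comp_assoc := fun o1 o2 o3 o4 (f : OpticMor o1 o2) (g : OpticMor o2 o3)
         (h : OpticMor o3 o4) =>
       OpticMor_eq (r := optic_comp (optic_comp f g) h)
         (s := optic_comp f (optic_comp g h))
         (comp_assoc (reparam f) (reparam g) (reparam h)) |}.

Definition LensDiscrete : Category := discrete (Lens M A A' B B').

Context {K : Cartesian M}.

Definition reify (l : LensDiscrete) : TwoOptic :=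
  {| residual := A; fw := graph (lget l); bw := lput l |}.

Definition erase (o : TwoOptic) : LensDiscrete :=
  {| lget := fw o ;; pi2;
     lput := ((fw o ;; pi1) ⊗₁ idm B') ;; bw o |}.

End OpticCategory.

Arguments reify {C M A A' B B' K} l.
Arguments erase {C M A A' B B' K} o.

(* Main.v *)
(** Reifying and then erasing a lens gives the lens back, because
    [graph f ;; pi1] is the identity and [graph f ;; pi2 = f].  An optic
    morphism does not change the erased lens, so the eraser is a functor to a
    discrete category, where every natural transformation is an identity.  The
    counit is an optic morphism because [fw] is the pairing of its two
    components; its naturality and the left triangle law reduce to
    [(r ⊗₁ idm B) ;; pi1 = pi1 ;; r] and [graph f ;; pi1 = idm A]. *)

From Stdlib Require Import FunctionalExtensionality ProofIrrelevance.
Require Import Defs.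

Set Implicit Arguments.
Unset Strict Implicit.
Unset Printing Implicit Defensive.

Lemma discrete_hom_eq (T : Type) (x y : discrete T) (p q : Hom x y) : p = q.
Proof. exact (proof_irrelevance (x = y :> T) p q). Qed.

(** Matching on [p] makes the value at [eq_refl] compute to an identity, so preservation of
    identities holds by conversion. *)
Definition discrete_fmap (T : Type) (D : Category) (F : T -> D) (x y : T)
  (p : x = y) : Hom (F x) (F y) :=
  match p in _ = z return Hom (F x) (F z) with eq_refl => idm (F x) end.

Lemma discrete_fmap_comp (T : Type) (D : Category) (F : T -> D) (x y z : T)
  (p : x = y) (q : y = z) :
  discrete_fmap F (eq_trans p q) = discrete_fmap F p ;; discrete_fmap F q.
Proof. destruct q, p; symmetry; apply comp_idl. Qed.

Definition discrete_functor_on (T : Type) (D : Category) (F : T -> D) :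
  @FunctorOn (discrete T) D F :=
  {| fmap_on := (fun x y p => discrete_fmap F p)
       : forall x y : discrete T, Hom x y -> Hom (F x) (F y);
     fmap_on_id := fun x => eq_refl;
     fmap_on_comp := fun x y z p q => discrete_fmap_comp F p q |}.

Lemma discrete_fmap_is_identity (T : Type) (D : Category) (F : T -> D) (x y : T)
  (p : x = y) : is_identity (discrete_fmap F p).
Proof. destruct p; constructor. Qed.

(** A functor to a discrete category amounts to an object map that is constant along morphisms; both
    laws equate proofs of the same equality. *)
Definition functor_on_discrete (C : Category) (T : Type) (F : C -> T)
  (HF : forall A B : C, Hom A B -> F A = F B) : @FunctorOn C (discrete T) F :=
  {| fmap_on := HF : forall A B : C, Hom A B -> @Hom (discrete T) (F A) (F B);
     fmap_on_id := fun _ => discrete_hom_eq _ _;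
     fmap_on_comp := fun _ _ _ _ _ => discrete_hom_eq _ _ |}.

Lemma discrete_is_identity (T : Type) (x y : discrete T) (p : Hom x y) :
  is_identity p.
Proof. destruct p; exact (is_identity_idm (x : discrete T)). Qed.

Lemma functor_on_discrete_eq (C : Category) (T : Type) (F : C -> discrete T)
  (s t : FunctorOn F) : s = t.
Proof.
destruct s as [s s_id s_comp], t as [t t_id t_comp].
assert (st : s = t).
{ apply functional_extensionality_dep; intros A.
  apply functional_extensionality_dep; intros B.
  apply functional_extensionality; intros f; apply discrete_hom_eq. }
subst t; f_equal; apply proof_irrelevance.
Qed.

Lemma discrete_is_identity_trans (C : Category) (T : Type)
  (F G : Functor C (discrete T)) (t : NatTrans F G) : is_identity_trans t.
Proof.
destruct F as [F Fs], G as [G Gs].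
assert (FG : F = G).
(* A component of [t] is a morphism of [discrete T], hence itself a proof of [F A = G A]. *)
{ apply functional_extensionality; intros A; exact (nat_at t A). }
(* The type of [t] mentions [Gs], so [t] goes back into the goal before [Gs] is replaced by [Fs]. *)
subst G; revert t; rewrite (functor_on_discrete_eq Gs Fs); intros t.
enough (H : t = nat_id _) by (rewrite H; constructor).
destruct t as [t t_nat]; unfold nat_id.
assert (E : t = fun A => idm (F A)).
{ apply functional_extensionality_dep; intros A; apply discrete_hom_eq. }
subst t; f_equal; apply proof_irrelevance.
Qed.

Section CartesianLemmas.
Context {C : Category} {M : SymMonoidal C} {K : Cartesian M}.

Lemma pairing_ext (Z X Y : C) (h k : Hom Z (X ⊗ Y)) :
  h ;; pi1 = k ;; pi1 -> h ;; pi2 = k ;; pi2 -> h = k.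
Proof.
intros E1 E2; rewrite (pairing_unique h), (pairing_unique k), E1, E2.
reflexivity.
Qed.

Lemma thom_pi1 (X X' Y Y' : C) (f : Hom X X') (g : Hom Y Y') :
  (f ⊗₁ g) ;; pi1 = pi1 ;; f.
Proof. rewrite thom_pairing; apply pairing_pi1. Qed.

Lemma thom_pi2 (X X' Y Y' : C) (f : Hom X X') (g : Hom Y Y') :
  (f ⊗₁ g) ;; pi2 = pi2 ;; g.
Proof. rewrite thom_pairing; apply pairing_pi2. Qed.

Lemma graph_pi1 (X Y : C) (f : Hom X Y) : graph f ;; pi1 = idm X.
Proof.
unfold graph, diag.
rewrite comp_assoc, thom_pi1, <- comp_assoc, pairing_pi1; apply comp_idl.
Qed.

Lemma graph_pi2 (X Y : C) (f : Hom X Y) : graph f ;; pi2 = f.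
Proof.
unfold graph, diag.
rewrite comp_assoc, thom_pi2, <- comp_assoc, pairing_pi2; apply comp_idl.
Qed.

(** With [f] and [g] the two components of [fw o], this is the forward condition on the counit. *)
Lemma graph_thom (X Y Z : C) (f : Hom X Y) (g : Hom X Z) :
  graph f ;; (g ⊗₁ idm Y) = pairing g f.
Proof.
apply pairing_ext; rewrite comp_assoc.
- rewrite thom_pi1, <- comp_assoc, graph_pi1, comp_idl, pairing_pi1.
  reflexivity.
- rewrite thom_pi2, <- comp_assoc, graph_pi2, comp_idr, pairing_pi2.
  reflexivity.
Qed.

End CartesianLemmas.

Section ResidualAdjunction.
Context {C : Category} {M : SymMonoidal C} {K : Cartesian M} {A A' B B' : C}.

Lemma erase_reify (l : LensDiscrete M A A' B B') : erase (reify l) = l.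
Proof.
destruct l as [f f']; unfold erase; simpl.
rewrite graph_pi1, graph_pi2, thom_id, comp_idl; reflexivity.
Qed.

Lemma optic_mor_fw_pi1 (o1 o2 : TwoOptic M A A' B B') (r : Hom o1 o2) :
  fw o2 ;; pi1 = fw o1 ;; pi1 ;; reparam r.
Proof.
destruct (reparamP r) as [Hfw _].
rewrite <- Hfw, !comp_assoc, thom_pi1; reflexivity.
Qed.

(** The morphism [r] acts on the residual only, so the get part is unchanged; in the put part, the
    factor [r] gained by the forward map is absorbed by the backward map. *)
Lemma erase_optic_mor (o1 o2 : TwoOptic M A A' B B') (r : Hom o1 o2) :
  erase o1 = erase o2.
Proof.
unfold erase; rewrite (optic_mor_fw_pi1 r).
destruct (reparamP r) as [Hfw Hbw].
rewrite <- Hfw, <- Hbw; f_equal.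
- rewrite comp_assoc, thom_pi2, comp_idr; reflexivity.
- rewrite <- comp_assoc, <- thom_comp, comp_idl; reflexivity.
Qed.

Lemma counit_is_optic_mor (o : TwoOptic M A A' B B') :
  is_optic_mor (o1 := reify (erase o)) (o2 := o) (fw o ;; pi1).
Proof.
(* The backward condition is the definition of the put part of [erase o]. *)
split; simpl; [|reflexivity].
rewrite graph_thom; symmetry; apply pairing_unique.
Qed.

Definition reifier : Functor (LensDiscrete M A A' B B') (TwoOptic M A A' B B') :=
  {| fobj := reify; fstr := discrete_functor_on reify |}.

Definition eraser : Functor (TwoOptic M A A' B B') (LensDiscrete M A A' B B') :=
  {| fobj := erase; fstr := functor_on_discrete erase_optic_mor |}.

(** Every reified lens has residual [A], so [idm A] typechecks here even for distinct variables [l1]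
    and [l2]; this removes the transport along [p] from later equations. *)
Lemma reparam_fmap_reifier (l1 l2 : LensDiscrete M A A' B B') (p : Hom l1 l2) :
  reparam (fmap reifier p) = idm A.
Proof. destruct p; reflexivity. Qed.

(** The unit at [l] points from [l] to [erase (reify l)], hence the [eq_sym]. *)
Definition residual_unit :
  NatTrans (functor_id _) (functor_comp reifier eraser) :=
  {| nat_at := (fun l => eq_sym (erase_reify l))
       : forall l, Hom (functor_id _ l) (functor_comp reifier eraser l);
     nat_natural := fun _ _ _ => discrete_hom_eq _ _ |}.

Definition residual_counit_at (o : TwoOptic M A A' B B') :
  Hom (functor_comp eraser reifier o) (functor_id _ o) :=
  {| reparam := fw o ;; pi1 : Hom (residual (reify (erase o))) (residual o);
     reparamP := counit_is_optic_mor o |}.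

Lemma residual_counit_natural (o1 o2 : TwoOptic M A A' B B') (r : Hom o1 o2) :
  fmap (functor_comp eraser reifier) r ;; residual_counit_at o2
  = residual_counit_at o1 ;; fmap (functor_id _) r.
Proof.
apply OpticMor_eq.
(* Optic morphisms compose through their reparameterisations, so the square unfolds to an equation
   in [C]. *)
change (reparam (fmap reifier (fmap eraser r)) ;; (fw o2 ;; pi1)
        = fw o1 ;; pi1 ;; reparam r).
rewrite reparam_fmap_reifier, <- optic_mor_fw_pi1; apply comp_idl.
Qed.

Definition residual_counit :
  NatTrans (functor_comp eraser reifier) (functor_id _) :=
  {| nat_at := residual_counit_at; nat_natural := residual_counit_natural |}.

Lemma residual_triangle_left (l : LensDiscrete M A A' B B') :
  fmap reifier (residual_unit l) ;; residual_counit (reifier l)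
  = idm (reifier l).
Proof.
apply OpticMor_eq.
change (reparam (fmap reifier (residual_unit l)) ;; (graph (lget l) ;; pi1)
        = idm A).
rewrite reparam_fmap_reifier, graph_pi1; apply comp_idl.
Qed.

Definition residual_adjunction : Adjunction reifier eraser :=
  {| adj_unit := residual_unit;
     adj_counit := residual_counit;
     adj_triangle_left := residual_triangle_left;
     adj_triangle_right := fun _ => discrete_hom_eq _ _ |}.

End ResidualAdjunction.

Theorem theorem1 (C : Category) (M : SymMonoidal C) (strictM : is_strict M)
    (K : Cartesian M) (A A' B B' : C) :
  exists (Rstr : @FunctorOn (LensDiscrete M A A' B B') (TwoOptic M A A' B B') reify)
         (Estr : @FunctorOn (TwoOptic M A A' B B') (LensDiscrete M A A' B B') erase),
  let R : Functor (LensDiscrete M A A' B B') (TwoOptic M A A' B B') :=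
    {| fobj := reify; fstr := Rstr |} in
  let E : Functor (TwoOptic M A A' B B') (LensDiscrete M A A' B B') :=
    {| fobj := erase; fstr := Estr |} in
  (forall (l1 l2 : LensDiscrete M A A' B B') (p : Hom l1 l2),
     is_identity (fmap R p)) /\
  (forall (o1 o2 : TwoOptic M A A' B B') (r : Hom o1 o2),
     is_identity (fmap E r)) /\
  exists adj : Adjunction R E,
    is_identity_trans (adj_unit adj) /\
    (forall o : TwoOptic M A A' B B',
       reparam (adj_counit adj o) = fw o ;; pi1).
Proof.
(* With these witnesses [R] and [E] are convertible to [reifier] and [eraser], so
   [residual_adjunction] applies as it stands. *)
exists (discrete_functor_on reify), (functor_on_discrete erase_optic_mor).
split; [|split].
- intros l1 l2 p; exact (discrete_fmap_is_identity reify p).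
- intros o1 o2 r; apply discrete_is_identity.
- exists residual_adjunction; split.
  + apply discrete_is_identity_trans.
  + reflexivity.
Qed.
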